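(* Let $F$ be Thompson's group, given by the presentation $\langle x_0, x_1, x_2, \ldots \mid x_i^{-1} x_n x_i = x_{n+1} \text{ for } 0 \le i < n\rangle$, and equip $F$ with the word metric with respect to its finite generating set $\{x_0, x_1\}$. Let $\Z \wr \Z$ (with $\Z$ denoting the integers, $\mathbb{Z}$) be the wreath product $\mathbb{Z} \wr \mathbb{Z} = \langle a, t \mid [t^{-i} a t^{i},\, t^{-j} a t^{j}],\ i, j \in \mathbb{Z}\rangle$. Let $h = x_1^2 x_2^{-1} x_1^{-1} \in F$, and let $H$ be the subgroup of $F$ generated by $x_0$ and $h$, which is isomorphic to $\mathbb{Z} \wr \mathbb{Z}$ via $\phi : \mathbb{Z}\wr\mathbb{Z} \to F$ with $\phi(t) = x_0$ and $\phi(a) = h$. Then $H$ is undistorted in $F$.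
   Context: Commutators are $[x,y] = x y x^{-1} y^{-1}$. Thompson's group $F$ is generated by $x_0$ and $x_1$, with $x_{n+1} = x_0^{-1} x_n x_0$ for $n \ge 1$; in particular $x_2 = x_0^{-1} x_1 x_0$. For a group $K$ with finite generating set $S$, $|g|_K$ denotes the word length of $g \in K$ with respect to $S$, i.e. the least length of a word in $S \cup S^{-1}$ representing $g$. Here $|\cdot|_F$ is taken with respect to $\{x_0, x_1\}$ and $|\cdot|_H$ with respect to $\{x_0, h\}$ (equivalently, under $\phi$, word length in $\mathbb{Z}\wr\mathbb{Z}$ with respect to $\{a,t\}$). A finitely generated subgroup $H$ of a finitely generated group $F$ is undistorted if the word metric on $H$ is linearly comparable with the restriction to $H$ of the word metric of $F$; that is, there is a constant $C \ge 1$ such that $\frac{1}{C}|g|_H \le |g|_F \le C\,|g|_H$ for all $g \in H$. *)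

(* Defs.v *)
From HB Require Import structures.
From mathcomp Require Import all_boot all_order all_algebra.
From mathcomp Require Import boolp classical_sets reals.

Set Implicit Arguments.
Unset Strict Implicit.
Unset Printing Implicit Defensive.

Import Order.TTheory GRing.Theory Num.Theory.

Local Open Scope classical_set_scope.
Local Open Scope group_scope.

(* The letter (x, false) stands for x and (x, true) for x^-1. *)
Definition word (X : Type) := seq (X * bool).

Definition lpos (X : Type) (x : X) : X * bool := (x, false).
Definition lneg (X : Type) (x : X) : X * bool := (x, true).

Definition winv (X : Type) (w : word X) : word X :=
  rev [seq (l.1, ~~ l.2) | l <- w].

Definition wcomm (X : Type) (u v : word X) : word X :=
  u ++ v ++ winv u ++ winv v.

Definition wpow (X : Type) (x : X) (i : int) : word X :=
  match i with
  | Posz n => nseq n (lpos x)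
  | Negz n => nseq n.+1 (lneg x)
  end.

(* rels u v is the relation u = v; pres_eq is the congruence it generates on
   words, together with free cancellation. *)
Inductive pres_eq (X : Type) (rels : word X -> word X -> Prop) :
    word X -> word X -> Prop :=
| pres_eq_refl u : pres_eq rels u u
| pres_eq_sym u v of pres_eq rels u v : pres_eq rels v u
| pres_eq_trans v u w of pres_eq rels u v & pres_eq rels v w : pres_eq rels u w
| pres_eq_cat u u' v v' of pres_eq rels u u' & pres_eq rels v v' :
    pres_eq rels (u ++ v) (u' ++ v')
| pres_eq_cancel x b : pres_eq rels [:: (x, b); (x, ~~ b)] [::]
| pres_eq_rel u v of rels u v : pres_eq rels u v.

Section Presented.
Variables (X : choiceType) (rels : word X -> word X -> Prop).

Definition pres_eqb : rel (word X) := fun u v => `[< pres_eq rels u v >].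

Lemma pres_eqb_equiv : equiv_class_of pres_eqb.
Proof.
split=> [u|u v|v u w]; first exact/asboolP/pres_eq_refl.
  by apply/asboolP/asboolP; apply: pres_eq_sym.
by move=> /asboolP uv /asboolP vw; apply/asboolP/(pres_eq_trans uv vw).
Qed.

Canonical pres_equiv := EquivRelPack pres_eqb_equiv.

Definition presented := {eq_quot pres_equiv}%qT.

HB.instance Definition _ := Choice.on presented.

Definition pres_word (w : word X) : presented := (\pi_{eq_quot pres_equiv} w)%qT.

Definition pres_gen (x : X) : presented := pres_word [:: lpos x].

Lemma pres_wordP u v : pres_word u = pres_word v <-> pres_eq rels u v.
Proof.
split; first by move/eqmodP/asboolP.
by move=> uv; apply/eqmodP/asboolP.
Qed.

Lemma pres_repr (g : presented) : pres_word (repr g) = g.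
Proof. by rewrite /pres_word reprK. Qed.

Lemma repr_pres w : pres_eq rels (repr (pres_word w)) w.
Proof. by apply/pres_wordP; rewrite pres_repr. Qed.

Lemma winv_cat (u v : word X) : winv (u ++ v) = winv v ++ winv u.
Proof. by rewrite /winv map_cat rev_cat. Qed.

Lemma winvK : involutive (@winv X).
Proof.
move=> u; rewrite /winv map_rev revK -map_comp -[RHS]map_id.
by apply: eq_map => -[x b] /=; rewrite negbK.
Qed.

Lemma pres_eq_catV u : pres_eq rels (u ++ winv u) [::].
Proof.
elim: u => [|[x b] u IH]; first exact: pres_eq_refl.
have -> : ((x, b) :: u) ++ winv ((x, b) :: u) =
    [:: (x, b)] ++ ((u ++ winv u) ++ [:: (x, ~~ b)]).
  by rewrite -cat1s winv_cat -!catA.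
apply: (@pres_eq_trans _ _ ([:: (x, b)] ++ ([::] ++ [:: (x, ~~ b)]))).
  apply: pres_eq_cat (pres_eq_refl _ _) _.
  exact: pres_eq_cat IH (pres_eq_refl _ _).
exact: pres_eq_cancel.
Qed.

Lemma pres_eq_winv u v : pres_eq rels u v -> pres_eq rels (winv u) (winv v).
Proof.
move=> uv.
apply: (@pres_eq_trans _ _ (winv u ++ (v ++ winv v))).
  rewrite -{1}[winv u]cats0; apply: pres_eq_cat (pres_eq_refl _ _) _.
  exact/pres_eq_sym/pres_eq_catV.
rewrite catA -[X in pres_eq _ _ X]cat0s.
apply: pres_eq_cat (pres_eq_refl _ _).
apply: (@pres_eq_trans _ _ (winv u ++ u)).
  by apply: pres_eq_cat (pres_eq_refl _ _) (pres_eq_sym uv).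
by rewrite -{2}[u]winvK; apply: pres_eq_catV.
Qed.

Definition pres_mul (g k : presented) : presented :=
  pres_word (repr g ++ repr k).
Definition pres_one : presented := pres_word [::].
Definition pres_inv (g : presented) : presented := pres_word (winv (repr g)).

Lemma pres_mulE u v : pres_mul (pres_word u) (pres_word v) = pres_word (u ++ v).
Proof. by apply/pres_wordP/pres_eq_cat; apply: repr_pres. Qed.

Lemma pres_invE u : pres_inv (pres_word u) = pres_word (winv u).
Proof. by apply/pres_wordP/pres_eq_winv/repr_pres. Qed.

Lemma pres_mulA : associative pres_mul.
Proof.
move=> f g k; rewrite -[f]pres_repr -[g]pres_repr -[k]pres_repr.
by rewrite !pres_mulE catA.
Qed.

Lemma pres_mul1g : left_id pres_one pres_mul.
Proof. by move=> g; rewrite -[g]pres_repr pres_mulE. Qed.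

Lemma pres_mulg1 : right_id pres_one pres_mul.
Proof. by move=> g; rewrite -[g]pres_repr pres_mulE cats0. Qed.

Lemma pres_mulVg : left_inverse pres_one pres_inv pres_mul.
Proof.
move=> g; rewrite -[g]pres_repr pres_invE pres_mulE.
by apply/pres_wordP; rewrite -{2}[repr g]winvK; apply: pres_eq_catV.
Qed.

Lemma pres_mulgV : right_inverse pres_one pres_inv pres_mul.
Proof.
move=> g; rewrite -[g]pres_repr pres_invE pres_mulE.
exact/pres_wordP/pres_eq_catV.
Qed.

HB.instance Definition _ := isGroup.Build presented
  pres_mulA pres_mul1g pres_mulg1 pres_mulVg pres_mulgV.

Lemma pres_wordM u v : pres_word (u ++ v) = pres_word u * pres_word v.
Proof. by rewrite -pres_mulE. Qed.

Lemma pres_wordV u : pres_word (winv u) = (pres_word u)^-1.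
Proof. by rewrite -pres_invE. Qed.

Lemma pres_word1 : pres_word [::] = 1.
Proof. by []. Qed.

End Presented.

Definition generated (G : groupType) (S : seq G) : set G :=
  [set g | forall K : {pred G}, group_closed K -> {subset S <= K} -> g \in K].

Definition word_for (G : groupType) (S : seq G) (g : G) (w : seq G) : Prop :=
  {in w, forall s, s \in S \/ s^-1 \in S} /\ \prod_(s <- w) s = g.

Definition has_word_of_size (G : groupType) (S : seq G) (g : G) : pred nat :=
  fun n => `[< exists w : seq G, word_for S g w /\ size w = n >].

(* The value 0 is a dummy one when g is not in the subgroup generated by S. *)
Definition word_length (G : groupType) (S : seq G) (g : G) : nat :=
  if pselect (exists n, has_word_of_size S g n) is left e then ex_minn e else 0.

(* S is meant to generate G; the subgroup is the one generated by T. *)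
Definition undistorted (R : realType) (G : groupType) (S T : seq G) : Prop :=
  exists C : R, (1 <= C)%R /\
    forall g : G, generated T g ->
      ((1 / C) * (word_length T g)%:R <= (word_length S g)%:R)%R /\
      ((word_length S g)%:R <= C * (word_length T g)%:R)%R.

Lemma generatedP (G : groupType) (S : seq G) (g : G) :
  generated S g <-> exists w, word_for S g w.
Proof.
split=> [gS|[w [wS <-]] K Kgrp SK].
  pose K : {pred G} := fun k => `[< exists w, word_for S k w >].
  have KP k : reflect (exists w, word_for S k w) (k \in K) by apply: asboolP.
  apply/KP/gS; last first.
    move=> s sS; apply/KP; exists [:: s]; split; last by rewrite big_seq1.
    by move=> ? /[!inE] /eqP ->; left.
  split; first by apply/KP; exists [::]; split; rewrite ?big_nil.
  move=> _ _ /KP[u [uS <-]] /KP[v [vS <-]]; apply/KP.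
  exists (u ++ rev [seq s^-1 | s <- v]); split.
    move=> s; rewrite mem_cat mem_rev => /orP[/uS //|/mapP[r /vS rS ->]].
    by rewrite invgK; tauto.
  rewrite big_cat /=; congr (_ * _).
  elim: v {vS} => [|s v IH]; first by rewrite !big_nil invg1.
  by rewrite /= rev_cons -cats1 big_cat big_seq1 IH big_cons invgM.
elim: w wS => [|s w IH] wS; first by rewrite big_nil Kgrp.1.
rewrite big_cons; apply: (group_closedM Kgrp).
  case: (wS s (mem_head _ _)) => [/SK //|/SK].
  by move/(group_closedV Kgrp); rewrite invgK.
by apply: IH => r rw; apply: wS; rewrite inE rw orbT.
Qed.

Inductive thompson_rel : word nat -> word nat -> Prop :=
| ThompsonRel i n of (i < n)%N :
    thompson_rel [:: lneg i; lpos n; lpos i] [:: lpos n.+1].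

Definition thompsonF : groupType := presented thompson_rel.

Definition xF (n : nat) : thompsonF := pres_gen thompson_rel n.

Definition hF : thompsonF := xF 1 ^+ 2 * (xF 2)^-1 * (xF 1)^-1.

Lemma xF_rel i n : (i < n)%N -> (xF i)^-1 * xF n * xF i = xF n.+1.
Proof.
move=> lt_in; rewrite /xF /pres_gen -(pres_wordV _ [:: lpos i]).
rewrite -(pres_wordM _ _ [:: lpos n]) -(pres_wordM _ _ [:: lpos i]).
by apply/pres_wordP/pres_eq_rel; apply: ThompsonRel.
Qed.

Lemma thompson_generated : generated [:: xF 0; xF 1] = setT.
Proof.
apply/seteqP; split=> // g _ K Kgrp SK.
have KM := group_closedM Kgrp; have KV := group_closedV Kgrp.
have K0 : xF 0 \in K by apply: SK; rewrite inE eqxx.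
have Kx n : xF n \in K.
  case: n => // n; elim: n => [|n IH]; first by apply: SK; rewrite !inE eqxx orbT.
  by rewrite -(@xF_rel 0) //; apply/KM/K0/KM/IH/KV.
rewrite -[g]pres_repr; elim: (repr g) => [|[n b] w IH]; first exact: Kgrp.1.
rewrite -cat1s pres_wordM; apply: KM IH; case: b; last exact: Kx.
by have := KV _ (Kx n); rewrite /xF /pres_gen -pres_wordV.
Qed.

Definition idx_a : bool := true.
Definition idx_t : bool := false.

Definition wreath_conj (i : int) : word bool :=
  wpow idx_t (- i)%R ++ [:: lpos idx_a] ++ wpow idx_t i.

Inductive wreath_rel : word bool -> word bool -> Prop :=
| WreathRel (i j : int) :
    wreath_rel (wcomm (wreath_conj i) (wreath_conj j)) [::].

Definition ZwrZ : groupType := presented wreath_rel.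

Definition aW : ZwrZ := pres_gen wreath_rel idx_a.
Definition tW : ZwrZ := pres_gen wreath_rel idx_t.

(* Main.v *)
Require Import Defs.
From HB Require Import structures.
From mathcomp Require Import all_boot all_order all_algebra.
From mathcomp Require Import boolp classical_sets reals.
From mathcomp Require Import zify lra.

(** The idea is to let F act on the line and to read off, from that action,
    all the data that determine the length of an element of H.

    F has a model by piecewise linear homeomorphisms of the line in which x_0 is
    the translation by 1 and x_n, for n >= 1, fixes everything up to n - 1, has
    slope 2 on the next unit interval and is the translation by 1 after it.  This
    action carries an integer valued cocycle [coc]: x_0 contributes nothing and
    x_n contributes 1 at the single point n - 1, so that [coc g x] counts, with
    signs, how often the generators applied in turn to x meet their first break
    point.  In other words F acts on rat * int, the first factor being the line
    and the second a counter ([letter_act], [letter_actR]).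

    In this model h fixes every integer, and its cocycle on the integers is the
    indicator of 0 ([F_act_hF]).  Put b_i = x_0^-i h x_0^i.  The b_i commute,
    because h commutes with x_n for n >= 2, so there is a homomorphism from the
    wreath product onto H, and every element of the wreath product is
    a product of powers b_i^(f i) times t^k.  Its image in F moves each integer m
    to m + k with cocycle f m ([ZwrZ_form]); so f and k are determined by that
    image, which gives injectivity.

    For undistortion, let g in H have length n in F.  A letter x_0^+-1, x_1^+-1
    moves points by at most 1, and its cocycle is bounded by the indicator of 0.
    Hence |k| <= n, f vanishes outside [-n, n], and the sum of the |f i| is at
    most n ([pos_bound], [coc_support], [coc_sum_bound]).  On the other hand
    walking once from one end of [-n, n] to the other writes g as a word in x_0
    and h of length at most 4 n + sum |f i| + |k| <= 6 n ([length_le_sweep]).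
    The other inequality holds because h is a word of length 6 in x_0 and x_1. *)

Set Implicit Arguments.
Unset Strict Implicit.
Unset Printing Implicit Defensive.

Import Order.TTheory GRing.Theory Num.Theory.

Local Open Scope classical_set_scope.
Local Open Scope group_scope.

(** * Integer powers *)

Section IntegerPowers.
Variable G : groupType.
Implicit Types (x y : G) (z : int).

Definition expz x z : G :=
  match z with Posz n => x ^+ n | Negz n => x ^- n.+1 end.

Lemma expzS x z : expz x (z + 1)%R = expz x z * x.
Proof.
case: z => [n|[|n]].
- by rewrite -PoszD addn1 /= expgSr.
- by rewrite /= expg1 mulVg.
have -> : (Negz n.+1 + 1 = Negz n)%R by lia.
by rewrite /= [x ^+ n.+2]expgS invgM mulgVK.
Qed.

Lemma expzP x z : expz x (z - 1)%R = expz x z * x^-1.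
Proof. by rewrite -{2}[z](subrK 1%R) expzS mulgK. Qed.

Lemma expzD x z1 z2 : expz x (z1 + z2)%R = expz x z1 * expz x z2.
Proof.
elim/int_rect: z2 => [|n IH|n IH]; first by rewrite addr0 mulg1.
  by rewrite -[n.+1]addn1 PoszD addrA !expzS IH mulgA.
by rewrite -[n.+1]addn1 PoszD opprD addrA !expzP IH mulgA.
Qed.

Lemma expzN x z : expz x (- z)%R = (expz x z)^-1.
Proof. by symmetry; apply: mulg1_eq; rewrite -expzD subrr. Qed.

Lemma commute_expz x y z : commute x y -> commute x (expz y z).
Proof. by case: z => n xy; [exact: commuteX | exact/commuteV/commuteX]. Qed.

Lemma conj_expz x y z : expz (x ^ y) z = expz x z ^ y.
Proof. by case: z => n /=; rewrite ?conjVg conjXg. Qed.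

End IntegerPowers.

Lemma gmulf_expz (G H : groupType) (f : UMagmaMorphism.type G H) x z :
  f (expz x z) = expz (f x) z.
Proof. by case: z => n; rewrite /= ?gmulfXVn ?gmulfXn. Qed.

(** * Maps out of a presented group *)

Section UniversalProperty.
Variables (X : choiceType) (rels : word X -> word X -> Prop).

Section Hom.
Variables (G : groupType) (f : X -> G).

Definition letter_eval (l : X * bool) : G := if l.2 then (f l.1)^-1 else f l.1.
Definition word_eval (w : word X) : G := \prod_(l <- w) letter_eval l.

Lemma word_eval_cat u v : word_eval (u ++ v) = word_eval u * word_eval v.
Proof. exact: big_cat. Qed.

Lemma word_eval1 l : word_eval [:: l] = letter_eval l.
Proof. exact: big_seq1. Qed.

Lemma word_eval_winv u : word_eval (winv u) = (word_eval u)^-1.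
Proof.
elim: u => [|[x b] u IH]; first by rewrite /word_eval big_nil invg1.
rewrite -cat1s winv_cat !word_eval_cat IH invgM !word_eval1 /letter_eval /=.
by case: b; rewrite ?invgK.
Qed.

Lemma word_eval_wpow x i : word_eval (wpow x i) = expz (f x) i.
Proof.
have E n b : word_eval (nseq n (x, b)) = letter_eval (x, b) ^+ n.
  elim: n => [|n IH]; first by rewrite /word_eval big_nil.
  by rewrite -addn1 nseqD word_eval_cat IH word_eval1 expgnDr.
by case: i => n; [exact: E | rewrite /= -expVgn; exact: (E n.+1 true)].
Qed.

Lemma word_eval_pres_eq u v :
  (forall u v, rels u v -> word_eval u = word_eval v) ->
  pres_eq rels u v -> word_eval u = word_eval v.
Proof.
move=> fR; elim=> {u v} [//|//|u v w _ -> //|u u' v v' _ uu' _ vv'|x b|//].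
  by rewrite !word_eval_cat uu' vv'.
rewrite -cat1s word_eval_cat !word_eval1 /letter_eval /word_eval big_nil.
by case: b; rewrite /= ?mulVg ?mulgV.
Qed.

Definition pres_lift (g : presented rels) : G := word_eval (repr g).

Hypothesis fR : forall u v, rels u v -> word_eval u = word_eval v.

Lemma pres_lift_word w : pres_lift (pres_word rels w) = word_eval w.
Proof. exact/word_eval_pres_eq/repr_pres. Qed.

Lemma pres_lift_gen x : pres_lift (pres_gen rels x) = f x.
Proof. by rewrite pres_lift_word word_eval1. Qed.

Lemma pres_lift1 : pres_lift 1 = 1.
Proof. by rewrite -(pres_word1 rels) pres_lift_word /word_eval big_nil. Qed.

Lemma pres_liftM : {morph pres_lift : g k / g * k}.
Proof.
move=> g k; rewrite -[g]pres_repr -[k]pres_repr -pres_wordM !pres_lift_word.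
exact: word_eval_cat.
Qed.

End Hom.

Lemma word_eval_gen w : word_eval (pres_gen rels) w = pres_word rels w.
Proof.
elim: w => [|[x b] w IH]; first by rewrite /word_eval big_nil.
rewrite -cat1s word_eval_cat pres_wordM IH word_eval1 /letter_eval /=.
by case: b; rewrite //= /pres_gen -pres_wordV.
Qed.

(** An action on the right: words act letter by letter, starting with the first
    one, so that a product acts through its left factor first. *)
Section Act.
Variables (Y : Type) (act : X * bool -> Y -> Y).

Definition word_act (w : word X) (y : Y) : Y := foldl (fun y l => act l y) y w.

Definition pres_act (g : presented rels) : Y -> Y := word_act (repr g).

Hypothesis actK : forall x b y, act (x, ~~ b) (act (x, b) y) = y.
Hypothesis actR : forall u v, rels u v -> word_act u =1 word_act v.

Lemma word_act_cat u v y : word_act (u ++ v) y = word_act v (word_act u y).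
Proof. exact: foldl_cat. Qed.

Lemma word_act_pres_eq u v : pres_eq rels u v -> word_act u =1 word_act v.
Proof.
elim=> {u v} [//|u v _ uv y|v u w _ uv _ vw y|u u' v v' _ uu' _ vv' y|x b y|//].
- by rewrite uv.
- by rewrite uv vw.
- by rewrite !word_act_cat uu' vv'.
exact: actK.
Qed.

Lemma pres_act_word w : pres_act (pres_word rels w) =1 word_act w.
Proof. exact/word_act_pres_eq/repr_pres. Qed.

Lemma pres_act_gen x : pres_act (pres_gen rels x) =1 act (x, false).
Proof. by move=> y; rewrite pres_act_word. Qed.

Lemma pres_act1 y : pres_act 1 y = y.
Proof. by rewrite -(pres_word1 rels) pres_act_word. Qed.

Lemma pres_actM g k y : pres_act (g * k) y = pres_act k (pres_act g y).
Proof.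
by rewrite -[g]pres_repr -[k]pres_repr -pres_wordM !pres_act_word word_act_cat.
Qed.

Lemma pres_actKV g y : pres_act g^-1 (pres_act g y) = y.
Proof. by rewrite -pres_actM mulgV pres_act1. Qed.

Lemma pres_actV_gen x : pres_act (pres_gen rels x)^-1 =1 act (x, true).
Proof.
move=> y; rewrite -{1}[y](actK x true) /= -pres_act_gen.
exact: pres_actKV.
Qed.

End Act.
End UniversalProperty.

(** * Upper bounds on word length *)

Section WordLength.
Variables (G : groupType) (S : seq G).
Implicit Types (g k s : G) (m n : nat).

(** Unlike a bound on [word_length], which is 0 by convention off the subgroup
    generated by S, this includes the membership in that subgroup. *)
Definition length_le g n := exists2 w, word_for S g w & size w <= n.

Lemma length_le1 : length_le 1 0.
Proof. by exists [::]; rewrite // /word_for big_nil. Qed.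

Lemma length_leM g k m n :
  length_le g m -> length_le k n -> length_le (g * k) (m + n).
Proof.
move=> [u [uS <-] um] [v [vS <-] vn]; exists (u ++ v).
  split; last exact: big_cat.
  by move=> s; rewrite mem_cat => /orP[/uS|/vS].
by rewrite size_cat leq_add.
Qed.

Lemma length_leW g m n : m <= n -> length_le g m -> length_le g n.
Proof. by move=> mn [w wS wm]; exists w => //; apply: leq_trans mn. Qed.

Lemma length_le_gen s : s \in S \/ s^-1 \in S -> length_le s 1.
Proof.
by move=> sS; exists [:: s] => //; split; [move=> ? /[!inE]/eqP-> | exact: big_seq1].
Qed.

Lemma length_leV g n : length_le g n -> length_le g^-1 n.
Proof.
move=> [w [wS <-] wn]; apply: (length_leW wn) => {wn}.
elim: w wS => [|s w IH] wS; first by rewrite big_nil invg1; exact: length_le1.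
rewrite big_cons invgM /= -addn1; apply: length_leM.
  by apply: IH => r rw; apply: wS; rewrite inE rw orbT.
by apply: length_le_gen; rewrite invgK; have := wS s (mem_head _ _); tauto.
Qed.

Lemma length_leX g m n : length_le g m -> length_le (g ^+ n) (n * m).
Proof.
move=> gm; elim: n => [|n IH]; first exact: length_le1.
by rewrite expgS mulSn; apply: length_leM.
Qed.

Lemma length_le_expz s z : s \in S -> length_le (expz s z) `|z|.
Proof.
move=> sS; have s1 : length_le s 1 by apply: length_le_gen; left.
by case: z => n /=; [|apply: length_leV]; rewrite -[X in length_le _ X]muln1;
  apply: length_leX.
Qed.

Lemma word_length_le g n : length_le g n -> word_length S g <= n.
Proof.
move=> [w wS wn]; apply: leq_trans wn.
rewrite /word_length; case: pselect => [e|//].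
by case: ex_minnP => m _; apply; apply/asboolP; exists w.
Qed.

Lemma word_length_attained g :
  generated S g -> exists2 w, word_for S g w & size w = word_length S g.
Proof.
move=> /generatedP[w wS]; rewrite /word_length.
case: pselect => [e|[]]; last by exists (size w); apply/asboolP; exists w.
by case: ex_minnP => m /asboolP[v [vS vm]] _; exists v.
Qed.

End WordLength.

(** * Normal form for lamplighter configurations *)

Section Sweep.
Variables (G : groupType) (a t : G).
Implicit Types (f : int -> int) (n : nat).

(** The integers of [-n, n] in increasing order; growing the interval at both
    ends is what makes the inductions on [sweep] work. *)
Fixpoint interval_seq n : seq int :=
  if n is m.+1 then Negz m :: rcons (interval_seq m) (Posz n) else [:: 0%R].

Lemma mem_interval_seq n i : (i \in interval_seq n) = (`|i| <= n)%N.
Proof.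
elim: n => [|n IH] /=; first by rewrite inE; case: i => [[]|].
by rewrite inE mem_rcons inE IH; lia.
Qed.

Lemma interval_seq_uniq n : uniq (interval_seq n).
Proof.
elim: n => //= n IH; rewrite rcons_uniq mem_rcons inE !mem_interval_seq IH; lia.
Qed.

Definition lamp (i : int) : G := a ^ expz t i.

Definition sweep n f : G := \prod_(i <- interval_seq n) expz (lamp i) (f i).

Lemma sweepS n f :
  sweep n.+1 f = expz (lamp (Negz n)) (f (Negz n)) * sweep n f
                 * expz (lamp n.+1) (f n.+1).
Proof. by rewrite /sweep /= big_cons big_rcons /= mulgA. Qed.

Lemma sweep_shrink m n f :
  (m <= n)%N -> (forall i, (m < `|i|)%N -> f i = 0%R) -> sweep n f = sweep m f.
Proof.
move=> mn f0; elim: n mn => [|n IH]; first by rewrite leqn0 => /eqP->.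
rewrite leq_eqVlt => /orP[/eqP-> //|mn].
by rewrite sweepS !f0 //= mul1g mulg1; exact: IH.
Qed.

(** In increasing order of i, the conjugating powers of t telescope to a single
    t^-1 between neighbours:
      sweep n f = t^n a^(f(-n)) t^-1 a^(f(1-n)) t^-1 ... a^(f n) t^n.
    The induction peels both ends off the part u between the two t^n. *)
Lemma length_le_sweep n f :
  length_le [:: t; a] (sweep n f)
    (4 * n + \sum_(i <- interval_seq n) `|f i|)%N.
Proof.
suff [u -> lu] : exists2 u, sweep n f = t ^+ n * u * t ^+ n &
    length_le [:: t; a] u (2 * n + \sum_(i <- interval_seq n) `|f i|)%N.
  have lt : length_le [:: t; a] (t ^+ n) n.
    by apply: (@length_le_expz _ _ t n); rewrite mem_head.
  by apply: length_leW (length_leM (length_leM lt lu) lt); lia.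
have la z : length_le [:: t; a] (expz a z) `|z|.
  by apply: length_le_expz; rewrite !inE eqxx orbT.
have lV : length_le [:: t; a] t^-1 1.
  by apply: length_le_gen; right; rewrite invgK mem_head.
elim: n => [|n [u Eu lu]].
  exists (expz a (f 0%R)); last by rewrite /= big_seq1.
  by rewrite /sweep /= big_seq1 /lamp conjg1 mul1g mulg1.
exists (expz a (f (Negz n)) * t^-1 * u * t^-1 * expz a (f n.+1)).
  rewrite sweepS Eu /lamp !conj_expz /= !conjgE invgK !expgS !invgM -!mulgA.
  have tX : commute (t ^- n) t^-1.
    exact/commute_sym/commuteV/commute_sym/commuteV/commute_sym/commuteX.
  by rewrite (mulgA (t ^- n) t^-1) tX -!mulgA mulKg mulVKg.
rewrite /= big_cons big_rcons /=.
apply: length_leW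
  (length_leM (length_leM (length_leM (length_leM (la _) lV) lu) lV) (la _)).
lia.
Qed.

Hypothesis lampC : forall i j, commute (lamp i) (lamp j).

(** Lamps commute, so a new one can be moved to its place in the sweep. *)
Lemma sweep_mul_lamp n f j z : (`|j| <= n)%N ->
  sweep n f * expz (lamp j) z =
  sweep n (fun i => f i + if i == j then z else 0)%R.
Proof.
rewrite -mem_interval_seq /sweep; have := interval_seq_uniq n.
elim: (interval_seq n) => [//|i s IH] /= /andP[is_ us].
rewrite inE !big_cons => /orP[/eqP ji|js]; last first.
  have /negbTE-> : i != j by apply: contraNneq is_ => ->.
  by rewrite addr0 -mulgA IH.
rewrite -{}ji eqxx in is_ *.
rewrite expzD -!mulgA; congr (_ * _).
have -> : \prod_(k <- s) expz (lamp k) (f k + (if k == j then z else 0))%R =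
          \prod_(k <- s) expz (lamp k) (f k).
  apply: eq_big_seq => k ks; have /negbTE-> : k != j by apply: contraNneq is_ => <-.
  by rewrite addr0.
apply: commute_sym; apply: commute_prod => k _.
by apply/commute_expz/commute_sym/commute_expz.
Qed.

(** The configuration f, followed by a walk of k steps.  Asking for all large n,
    and not for one, amounts to finite support of f and spares any choice of an
    interval when two elements are multiplied. *)
Definition lamp_form (g : G) f (k : int) :=
  exists N, forall n, (N <= n)%N -> g = sweep n f * expz t k.

Lemma lamp_form1 : lamp_form 1 (fun=> 0%R) 0%R.
Proof.
by exists 0%N => n _; rewrite mulg1 /sweep big1.
Qed.

Lemma lamp_form_mul_shift g f k z :
  lamp_form g f k -> lamp_form (g * expz t z) f (k + z)%R.
Proof. by case=> N gN; exists N => n /gN->; rewrite expzD mulgA. Qed.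

(** A lamp lit after t^k is the lamp at -k: t^k a = (t^k a t^-k) t^k. *)
Lemma lamp_form_mul_lamp g f k z :
  lamp_form g f k ->
  lamp_form (g * expz a z) (fun i => f i + if i == - k then z else 0)%R k.
Proof.
case=> N gN; exists (maxn N `|k|) => n; rewrite geq_max => /andP[/gN-> kn].
rewrite -sweep_mul_lamp ?abszN // /lamp conj_expz conjgE expzN invgK.
by rewrite -!mulgA mulVg mulg1.
Qed.

Lemma lamp_form_shrink n g f k :
  lamp_form g f k -> (forall i, (n < `|i|)%N -> f i = 0%R) ->
  g = sweep n f * expz t k.
Proof.
case=> N gN f0; rewrite (gN (maxn N n) (leq_maxl _ _)).
by rewrite (sweep_shrink (leq_maxr _ _) f0).
Qed.

End Sweep.

Lemma gmulf_sweep (G H : groupType) (f : UMagmaMorphism.type G H) a t n e :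
  f (sweep a t n e) = sweep (f a) (f t) n e.
Proof.
rewrite gmulf_prod; apply: eq_bigr => i _.
by rewrite gmulf_expz /lamp gmulfJ gmulf_expz.
Qed.

(** * The piecewise linear action of Thompson's group and its cocycle *)

Definition push (a x : rat) : rat :=
  (if x <= a then x else if x <= a + 1 then 2 * x - a else x + 1)%R.
Definition pull (a x : rat) : rat :=
  (if x <= a then x else if x <= a + 2 then (x + a) / 2 else x - 1)%R.

Ltac plcase := repeat (case: lerP => ?); try lra.

Lemma pushK a : cancel (push a) (pull a).
Proof. by move=> x; rewrite /push; plcase; rewrite /pull; plcase. Qed.

Lemma pullK a : cancel (pull a) (push a).
Proof. by move=> x; rewrite /pull; plcase; rewrite /push; plcase. Qed.

Lemma push_le a x : (x <= a)%R -> push a x = x.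
Proof. by rewrite /push => ->. Qed.

Lemma push_ge a x : (a + 1 <= x)%R -> push a x = (x + 1)%R.
Proof. by move=> ax; rewrite /push; plcase. Qed.

(** The relation x_i^-1 x_n x_i = x_(n+1) for 0 < i < n, in the form
    x_n x_i = x_i x_(n+1): x_i is the unit translation on the part of the line
    that x_n moves. *)
Lemma push_push a b x : (a + 1 <= b)%R ->
  push a (push b x) = push (b + 1)%R (push a x).
Proof.
move=> ab; case: (lerP x b) => xb.
  rewrite (push_le xb) [RHS]push_le // /push.
  by case: (lerP x a) => ?; last case: (lerP x (a + 1)) => ?; lra.
have ax : (a + 1 <= x)%R by lra.
have bx : (x <= push b x)%R.
  by rewrite /push; case: (lerP x b) => ?; last case: (lerP x (b + 1)) => ?; lra.
rewrite !(@push_ge a) //; last exact: le_trans bx.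
rewrite /push !lerD2r; case: (lerP x b) => ?; last case: (lerP x (b + 1)) => ?; lra.
Qed.

Lemma eq_push_le a b x : (b <= a)%R -> (push a x == b) = (x == b).
Proof. by move=> ba; rewrite -[RHS](can_eq (pushK a)) [push a b]push_le. Qed.

Lemma eq_push_ge a b x : (a + 1 <= b)%R -> (push a x == b + 1)%R = (x == b).
Proof. by move=> ab; rewrite -(push_ge ab) (can_eq (pushK a)). Qed.

(** The letter x_(n+1) increments the counter at the break point n, which it
    fixes; this is why its inverse can test for n before moving. *)
Definition letter_act (l : nat * bool) (y : rat * int) : rat * int :=
  match l with
  | (0%N, false) => (y.1 + 1, y.2)%R
  | (0%N, true) => (y.1 - 1, y.2)%R
  | (n.+1, false) => (push n%:R y.1, y.2 + (y.1 == n%:R)%:R)%R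
  | (n.+1, true) => (pull n%:R y.1, y.2 - (y.1 == n%:R)%:R)%R
  end.

Lemma letter_actK n b y : letter_act (n, ~~ b) (letter_act (n, b) y) = y.
Proof.
case: y => x c; case: n b => [|n] [] /=.
- by rewrite subrK.
- by rewrite addrK.
- by rewrite pullK -(eq_push_le (pull n%:R x) (lexx n%:R%R)) pullK subrK.
- by rewrite pushK eq_push_le // addrK.
Qed.

(** The counters agree because x_i maps n - 1 to n and, when i >= 1, because
    x_n fixes i - 1: the contributions of x_i^-1 and x_i cancel. *)
Lemma letter_actR u v :
  thompson_rel u v -> word_act letter_act u =1 word_act letter_act v.
Proof.
case=> i n lt_in y; rewrite -[y](letter_actK i true).
move: (letter_act (i, true) y) => {y} [x c].
pose act m := letter_act (m, false).
transitivity (act i (act n (letter_act (i, true) (act i (x, c))))); first by [].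
transitivity (act n.+1 (act i (x, c))); last by [].
rewrite (letter_actK i false) {}/act.
case: n lt_in => // n lt_in; case: i lt_in => [|i] lt_in /=.
  rewrite -natr1 (inj_eq (addIr _)); congr (_, _).
  by rewrite /push; plcase.
have ? : (i%:R + 1 <= n%:R :> rat)%R by rewrite natr1 ler_nat.
rewrite -natr1 eq_push_ge // eq_push_le; last by lra.
by rewrite push_push // addrAC.
Qed.

Definition F_act (g : thompsonF) : rat * int -> rat * int :=
  pres_act letter_act g.

Definition pos (g : thompsonF) (x : rat) : rat := (F_act g (x, 0%R)).1.
Definition coc (g : thompsonF) (x : rat) : int := (F_act g (x, 0%R)).2.

Lemma F_act1 y : F_act 1 y = y.
Proof. exact: (pres_act1 letter_actK letter_actR). Qed.

Lemma F_actM g k y : F_act (g * k) y = F_act k (F_act g y).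
Proof. exact: (pres_actM letter_actK letter_actR). Qed.

Lemma F_actKV g y : F_act g^-1 (F_act g y) = y.
Proof. exact: (pres_actKV letter_actK letter_actR). Qed.

Lemma F_actK g y : F_act g (F_act g^-1 y) = y.
Proof. by rewrite -{1}[g]invgK F_actKV. Qed.

Lemma F_act_gen n y : F_act (xF n) y = letter_act (n, false) y.
Proof. exact: (pres_act_gen letter_actK letter_actR). Qed.

Lemma F_actV_gen n y : F_act (xF n)^-1 y = letter_act (n, true) y.
Proof. exact: (pres_actV_gen letter_actK letter_actR). Qed.

Lemma F_actE g x c : F_act g (x, c) = (pos g x, c + coc g x)%R.
Proof.
rewrite /pos /coc -[c in LHS]addr0 /F_act /pres_act; move: 0%R x.
elim: (repr g) => [|[[|n] []] w IH] e x //=; rewrite -?addrA IH //.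
all: by rewrite [X in letter_act X]/=.
Qed.

Lemma pos1 x : pos 1 x = x. Proof. by rewrite /pos F_act1. Qed.
Lemma coc1 x : coc 1 x = 0%R. Proof. by rewrite /coc F_act1. Qed.

Lemma posM g k x : pos (g * k) x = pos k (pos g x).
Proof. by rewrite {1}/pos F_actM F_actE F_actE. Qed.

Lemma cocM g k x : coc (g * k) x = (coc g x + coc k (pos g x))%R.
Proof. by rewrite {1}/coc F_actM F_actE F_actE add0r. Qed.

Lemma pos_inj g : injective (pos g).
Proof.
by apply: (can_inj (g := pos g^-1)) => x; rewrite -posM mulgV pos1.
Qed.

(** The break point of x_1 is 0, hence the cocycle of a letter is supported
    there and has absolute value at most 1. *)
Lemma letter_bounds s x : s \in [:: xF 0; xF 1] \/ s^-1 \in [:: xF 0; xF 1] ->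
  (`|pos s x - x| <= 1)%R /\ (`|coc s x| <= (x == 0%R))%N.
Proof.
have pushB y : (`|push 0 y - y| <= 1)%R.
  rewrite /push ler_norml; case: (lerP y 0) => ?; last case: (lerP y (0 + 1)) => ?;
    by apply/andP; split; lra.
rewrite !inE => -[] /orP[] /eqP => [->|->|/(canRL invgK)->|/(canRL invgK)->].
all: rewrite /pos /coc ?F_act_gen ?F_actV_gen [_.1]/= [_.2]/=.
- by rewrite addrAC subrr add0r normr1.
- by rewrite add0r; split=> //; case: eqP.
- by rewrite addrAC subrr add0r normrN1.
rewrite add0r; split; last by case: eqP.
by rewrite -{2}[x](pullK 0) distrC.
Qed.

Section WordBounds.
Variables (g : thompsonF) (w : seq thompsonF).
Hypothesis wg : word_for [:: xF 0; xF 1] g w.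

Lemma pos_bound x : (`|pos g x - x| <= (size w)%:R)%R.
Proof.
case: wg => + <-; elim: w x => [|s v IH] x vS; first by rewrite big_nil pos1 subrr normr0.
have [sx _] := letter_bounds x (vS s (mem_head _ _)).
have {IH} := IH (pos s x) (fun r rv => vS r (mem_behead (s := s :: v) rv)).
rewrite big_cons posM /= -natr1 => vx.
rewrite -(subrK (pos s x) (pos _ _)) -addrA; exact: le_trans (ler_normD _ _) (lerD vx sx).
Qed.

(** A point where the cocycle is nonzero has to be carried to 0 by a proper
    prefix of the word, at unit speed. *)
Lemma coc_support x : coc g x != 0%R -> (`|x| <= (size w)%:R)%R.
Proof.
case: wg => + <-; elim: w x => [|s v IH] x vS; first by rewrite big_nil coc1.
have [sx cx] := letter_bounds x (vS s (mem_head _ _)).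
have {IH} := IH (pos s x) (fun r rv => vS r (mem_behead (s := s :: v) rv)).
rewrite big_cons cocM /= -natr1 => vx.
have [->|x0] := eqVneq x 0%R; first by rewrite normr0 natr1 ler0n.
move: cx; rewrite (negbTE x0) leqn0 absz_eq0 => /eqP-> /[!add0r]/vx {}vx.
rewrite -[X in `|X|%R](subrK (pos s x)) addrC.
by apply: le_trans (ler_normD _ _) (lerD vx _); rewrite distrC.
Qed.

(** The first letter contributes at most 1 in total, and it maps the points of A
    injectively to the points at which the rest of the word is evaluated. *)
Lemma coc_sum_bound (A : seq rat) : uniq A -> (\sum_(x <- A) `|coc g x| <= size w)%N.
Proof.
case: wg => + <-; elim: w A => [|s v IH] A vS uA.
  by rewrite big1 // => x _; rewrite big_nil coc1.
have {IH} := IH (map (pos s) A) (fun r rv => vS r (mem_behead (s := s :: v) rv)).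
rewrite big_cons (map_inj_uniq (@pos_inj s)) big_map => /(_ uA) vA /=.
rewrite -addn1 addnC.
have: (\sum_(x <- A) `|coc s x| <= 1)%N.
  apply: (@leq_trans (\sum_(x <- A) (x == 0%R))).
    by apply: leq_sum => x _; case: (letter_bounds x (vS s (mem_head _ _))).
  suff -> : (\sum_(x <- A) (x == 0%R) = count_mem 0%R A)%N.
    by rewrite count_uniq_mem // leq_b1.
  by rewrite -sum1_count [RHS]big_mkcond; apply: eq_bigr => x _ /=; case: (x == _).
move=> /leq_add/(_ vA); apply: leq_trans.
by rewrite -big_split /= leq_sum // => x _; rewrite cocM; lia.
Qed.

End WordBounds.

(** * The homomorphism from the wreath product *)

Lemma lamp_commute_nat (G : groupType) (a t : G) :
  (forall n : nat, commute a (a ^ t ^+ n.+1)) ->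
  forall i j, commute (lamp a t i) (lamp a t j).
Proof.
move=> aC i j; wlog ij : i j / (i <= j)%R => [H|].
  by case/orP: (le_total i j) => ij; [|apply: commute_sym]; apply: H.
have -> : lamp a t j = lamp a t `|j - i|%N ^ expz t i.
  by rewrite /lamp -conjgM -expzD; congr (_ ^ expz _ _); lia.
case: `|_|%N => [|n]; first by rewrite /lamp conjg1; exact: commute_refl.
by rewrite /lamp /commute -!conjMg [in LHS](aC n).
Qed.

Lemma xFJ i n : (i < n)%N -> xF n ^ xF i = xF n.+1.
Proof. by move=> lt_in; rewrite conjgE mulgA xF_rel. Qed.

Lemma xFJX0 m n : xF m.+1 ^ xF 0 ^+ n = xF (m + n).+1.
Proof.
elim: n => [|n IH]; first by rewrite conjg1 addn0.
by rewrite expgSr conjgM IH xFJ // addnS.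
Qed.

(** Conjugation by x_1^2 shifts the index n by 2, and conjugation by x_2^-1 and
    then by x_1^-1 shifts it back. *)
Lemma hF_commute n : (1 < n)%N -> commute hF (xF n).
Proof.
move=> n1; apply/commute_sym/commgP; rewrite -conjg_fix /hF !conjgM.
rewrite !xFJ //; last by lia.
by rewrite -(@xFJ 2 n.+1) ?conjgK -?(@xFJ 1 n) ?conjgK.
Qed.

Lemma hF_lamp_commute i j : commute (lamp hF (xF 0) i) (lamp hF (xF 0) j).
Proof.
apply: lamp_commute_nat => n.
rewrite /hF !conjMg !conjVg !xFJX0 -/hF.
do ![apply: commuteM | apply: commuteV]; exact: hF_commute.
Qed.

Lemma word_eval_wreath_conj (G : groupType) (f : bool -> G) i :
  word_eval f (wreath_conj i) = lamp (f idx_a) (f idx_t) i.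
Proof.
by rewrite /wreath_conj !word_eval_cat !word_eval_wpow word_eval1 expzN.
Qed.

Lemma word_eval_wcomm (G : groupType) (X : choiceType) (f : X -> G) u v :
  word_eval f (wcomm u v) = 1 <-> commute (word_eval f u) (word_eval f v).
Proof.
rewrite /wcomm !word_eval_cat !word_eval_winv mulgA -invgM.
by split=> [/divg1_eq|->]; [|exact: divgg].
Qed.

Lemma ZwrZ_lamp_commute i j : commute (lamp aW tW i) (lamp aW tW j).
Proof.
rewrite -!(word_eval_wreath_conj (pres_gen wreath_rel)); apply/word_eval_wcomm.
by rewrite word_eval_gen; apply/pres_wordP/pres_eq_rel.
Qed.

Definition embed_gen (x : bool) : thompsonF := if x then hF else xF 0.

Lemma embed_gen_rel u v : wreath_rel u v -> word_eval embed_gen u = word_eval embed_gen v.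
Proof.
case=> i j; rewrite [RHS]big_nil; apply/word_eval_wcomm.
rewrite !word_eval_wreath_conj; exact: hF_lamp_commute.
Qed.

Definition embed : ZwrZ -> thompsonF := pres_lift embed_gen.

HB.instance Definition _ :=
  isMultiplicative.Build ZwrZ thompsonF embed (pres_liftM embed_gen_rel).
HB.instance Definition _ :=
  Multiplicative_isUMagmaMorphism.Build ZwrZ thompsonF embed (pres_lift1 embed_gen_rel).

Lemma embed_a : embed aW = hF. Proof. exact: (pres_lift_gen embed_gen_rel). Qed.
Lemma embed_t : embed tW = xF 0. Proof. exact: (pres_lift_gen embed_gen_rel). Qed.

Lemma range_embed : range embed = generated [:: xF 0; hF].
Proof.
apply/seteqP; split=> [_ [g _ <-] K Kgrp SK | g].
  have KM := group_closedM Kgrp; have KV := group_closedV Kgrp.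
  have Kx x : embed_gen x \in K by case: x; apply: SK; rewrite /= !inE eqxx ?orbT.
  rewrite -[g]pres_repr /embed (pres_lift_word embed_gen_rel) /word_eval.
  elim: (repr g) => [|[x b] w IH]; first by rewrite big_nil; exact: Kgrp.1.
  rewrite big_cons; apply: KM IH; rewrite /letter_eval.
  by case: b; [apply: KV|]; exact: Kx.
pose K : {pred thompsonF} := fun k => `[< range embed k >].
have KP k : reflect (range embed k) (k \in K) by apply: asboolP.
move=> gS; apply/KP/gS => [|s].
  split; first by apply/KP; exists 1; rewrite ?gmulf1.
  by move=> _ _ /KP[u _ <-] /KP[v _ <-]; apply/KP; exists (u / v); rewrite ?gmulfF.
by move=> /[!inE] /orP[] /eqP->; [exists tW|exists aW]; rewrite ?embed_a ?embed_t.
Qed.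

(** For x >= 1 the factors of h translate x by 1, 1, -1 and -1, and no counter
    moves.  For x <= 0 they fix x, and at 0 the counter goes up twice with x_1^2
    and down once with x_1^-1. *)
Lemma F_act_hF (x : rat) (c : int) : (x <= 0)%R \/ (1 <= x)%R ->
  F_act hF (x, c) = (x, c + (x == 0%R)%:R)%R.
Proof.
rewrite /hF expg2 !F_actM !F_act_gen !F_actV_gen [letter_act _ _]/=; case=> x0.
  have pullx b : (x <= b)%R -> pull b x = x by rewrite /pull => ->.
  rewrite !push_le ?pullx //; last by lra.
  have /negbTE-> : x != 1%R by apply/eqP; lra.
  by rewrite subr0 addrK.
rewrite !(@push_ge 0) ?add0r //; last by lra.
rewrite -(@push_ge 1%R (x + 1)%R) ?pushK; last by lra.
have -> : pull 0 (x + 1)%R = x by rewrite -(@push_ge 0 x) ?add0r // pushK.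
have /negbTE-> : push 1%R (x + 1)%R != 1%R.
  by rewrite eq_push_le //; apply/eqP; lra.
by rewrite subr0 addrK.
Qed.

(** * Elements of H, read off from their action on the integers *)

Definition letter_sign (b : bool) : int := if b then (-1)%R else 1%R.

Lemma letter_eval_expz (X : choiceType) (G : groupType) (f : X -> G) x b :
  letter_eval f (x, b) = expz (f x) (letter_sign b).
Proof. by rewrite /letter_eval; case: b. Qed.

Lemma F_act_t b (m c : int) :
  F_act (expz (xF 0) (letter_sign b)) (m%:~R, c)%R = ((m + letter_sign b)%:~R, c)%R.
Proof. by case: b; rewrite [expz _ _]/= ?F_act_gen ?F_actV_gen /= intrD. Qed.

Lemma F_act_h b (m c : int) :
  F_act (expz hF (letter_sign b)) (m%:~R, c)%R =
  (m%:~R, c + if m == 0 then letter_sign b else 0)%R.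
Proof.
have hE e : F_act hF (m%:~R, e)%R = (m%:~R, e + (m == 0)%:R)%R.
  by rewrite F_act_hF ?intr_eq0 // lerz0 ler1z; lia.
case: b; rewrite [expz _ _]/=; last by rewrite hE; case: (_ == _).
apply: (can_inj (F_actKV hF)); rewrite F_actK hE.
by case: eqP => _; rewrite ?addr0 ?subrK.
Qed.

(** The action follows the normal form: a letter a after t^k lights the lamp -k,
    which is the integer that t^k moves to 0, where the cocycle of h sits. *)
Lemma ZwrZ_form (g : ZwrZ) : exists f k,
  lamp_form aW tW g f k /\
  forall m c : int,
    F_act (embed g) (m%:~R, c)%R = ((m + k)%:~R, c + f m)%R.
Proof.
rewrite -[g]pres_repr; elim/last_ind: (repr g) => [|w [x b] [f [k [gfk wE]]]].
  exists (fun=> 0%R), 0%R; split; first exact: lamp_form1.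
  by move=> m c; rewrite gmulf1 F_act1 !addr0.
rewrite -cats1 pres_wordM -[X in _ * X]word_eval_gen word_eval1 letter_eval_expz.
case: x.
  exists (fun i => f i + if i == - k then letter_sign b else 0)%R, k; split.
    exact/lamp_form_mul_lamp/gfk/ZwrZ_lamp_commute.
  move=> m c; rewrite gmulfM F_actM wE gmulf_expz /= embed_a F_act_h.
  by rewrite addr_eq0 addrA.
exists f, (k + letter_sign b)%R; split; first exact: lamp_form_mul_shift.
by move=> m c; rewrite gmulfM F_actM wE gmulf_expz /= embed_t F_act_t addrA.
Qed.

(** The identity moves no integer and has zero cocycle, so the normal form of an
    element of the kernel is the empty one. *)
Lemma embed_inj : injective embed.
Proof.
apply: gmulf_inj => g pg1; have [f [k [gfk gE]]] := ZwrZ_form g.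
have actE m : ((m + k)%:~R, f m)%R = (m%:~R, 0%R)%R :> rat * int.
  by have := gE m 0%R; rewrite pg1 F_act1 add0r => <-.
have f0 m : f m = 0%R by case: (actE m).
have k0 : k = 0%R.
  by have [/eqP] := actE 0%R; rewrite eqr_int add0r => /eqP.
rewrite (lamp_form_shrink (n := 0) gfk) // k0 mulg1 /sweep big1 // => i _.
by rewrite f0.
Qed.

(** * Undistortion *)

(** On integers, displacement and cocycle of g are k and f, so the three bounds
    for words in x_0 and x_1 bound the length of the sweep that spells g. *)
Lemma length_le_H g : generated [:: xF 0; hF] g ->
  length_le [:: xF 0; hF] g (6 * word_length [:: xF 0; xF 1] g).
Proof.
rewrite -range_embed => -[g' _ gE].
have [w wg <-] : exists2 w, word_for [:: xF 0; xF 1] g w &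
    size w = word_length [:: xF 0; xF 1] g.
  by apply: word_length_attained; rewrite thompson_generated.
set n := size w; have [f [k [gfk]]] := ZwrZ_form g'.
rewrite gE => actE.
have posE m : pos g m%:~R%R = (m + k)%:~R%R by rewrite /pos actE.
have cocE m : coc g m%:~R%R = f m by rewrite /coc actE add0r.
have f0 i : (n < `|i|)%N -> f i = 0%R.
  apply: contraTeq; rewrite -cocE -leqNgt => /(coc_support wg).
  by rewrite -intr_norm -[_%:R%R]/(n%:Z%:~R)%R ler_int; lia.
have kn : (`|k| <= n)%N.
  have := pos_bound wg 0%:~R%R; rewrite posE add0r subr0.
  by rewrite -intr_norm -[_%:R%R]/(n%:Z%:~R)%R ler_int; lia.
have fn : (\sum_(i <- interval_seq n) `|f i| <= n)%N.
  have := coc_sum_bound wg (A := map intr (interval_seq n)).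
  rewrite map_inj_uniq ?interval_seq_uniq; last exact: intr_inj.
  by rewrite big_map => /(_ isT); under eq_bigr do rewrite cocE.
rewrite -gE (lamp_form_shrink gfk f0) gmulfM gmulf_sweep gmulf_expz.
rewrite /= embed_t embed_a.
apply: length_leW
  (length_leM (length_le_sweep _ _ _ _) (length_le_expz _ (mem_head _ _))).
lia.
Qed.

Lemma length_le_F g : generated [:: xF 0; hF] g ->
  length_le [:: xF 0; xF 1] g (6 * word_length [:: xF 0; hF] g).
Proof.
move=> /word_length_attained[w [wS <-] <-].
pose S := [:: xF 0; xF 1].
have l0 : length_le S (xF 0) 1 by apply: length_le_gen; left; rewrite !inE eqxx.
have l1 : length_le S (xF 1) 1 by apply: length_le_gen; left; rewrite !inE eqxx orbT.
have lh : length_le S hF 6.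
  (* h = x_1 x_1 (x_0^-1 x_1 x_0)^-1 x_1^-1 *)
  rewrite /hF -(@xF_rel 0 1) // expg2.
  exact: (length_leM (length_leM (length_leM l1 l1)
    (length_leV (length_leM (length_leM (length_leV l0) l1) l0)))
    (length_leV l1)).
have lS s : s \in [:: xF 0; hF] -> length_le S s 6.
  by rewrite !inE => /orP[] /eqP-> //; apply: length_leW l0.
elim: w wS => [|s w IH] wS; first by rewrite big_nil; exact: length_le1.
rewrite big_cons mulnS; apply: length_leM; last first.
  by apply: IH => r rw; apply: wS; rewrite inE rw orbT.
by case: (wS s (mem_head _ _)) => /lS // /length_leV; rewrite invgK.
Qed.

Theorem theorem3p1 (R : realType) :
  (exists phi : {multiplicative ZwrZ -> thompsonF},
     [/\ phi tW = xF 0, phi aW = hF, injective phi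
       & range phi = generated [:: xF 0; hF]])
  /\ undistorted R [:: xF 0; xF 1] [:: xF 0; hF].
Proof.
split.
  exists embed; split; [exact: embed_t | exact: embed_a | exact: embed_inj |].
  exact: range_embed.
exists 6%R; split=> [|g gH]; first by rewrite ler1n.
split; last by rewrite -natrM ler_nat; exact/word_length_le/length_le_F.
rewrite div1r ler_pdivrMl ?ltr0n // -natrM ler_nat.
exact/word_length_le/length_le_H.
Qed.
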